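(* Let $G$ be a countable amenable group. The Left Strong Ergodic Theorem holds for $G$ if and only if $G$ admits a firm strong sequence.
   Context: For a unitary representation $(\mathcal{H},\pi)$ of $G$, $P_G$ denotes the orthogonal projection onto the closed subspace of $\pi(G)$-invariant vectors. A sequence $(F_n)$ of (nonempty) finite subsets of $G$ is a left Følner sequence if $\lim_n |F_n\triangle tF_n|/|F_n|=0$ for all $t\in G$. The Left Strong Ergodic Theorem holds for $G$ if for every unitary representation $(\mathcal{H},\pi)$ of $G$, every left Følner sequence $(F_n)$ in $G$ and every $v\in\mathcal{H}$, $\lim_n\frac{1}{|F_n|}\sum_{s\in F_n}\pi(s)v=P_Gv$ in norm. A sequence $(K_m)$ of (nonempty) finite subsets of $G$ is a firm strong sequence with respect to $(\mathcal{H},\pi)$ if for every sequence $(t_m)$ in $G$ and every $v\in\mathcal{H}$, $\lim_m\frac{1}{|K_m|}\sum_{t\in K_m}\pi(tt_m)v=P_Gv$ in norm. It is a firm strong sequence in $G$ if it is a firm strong sequence with respect to every unitary representation of $G$. *)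

(* Defs.v *)
From HB Require Import structures.
From mathcomp Require Import all_boot all_order all_algebra finmap complex.
From mathcomp Require Import all_classical all_reals all_analysis.

Set Implicit Arguments.
Unset Strict Implicit.
Unset Printing Implicit Defensive.

Import Order.TTheory GRing.Theory Num.Theory.
Import numFieldNormedType.Exports.

Local Open Scope classical_set_scope.
Local Open Scope fset_scope.
Local Open Scope ring_scope.
Local Open Scope complex_scope.

(* A complex Hilbert space. The inner product is linear in the first variable
   and conjugate-linear in the second; the norm takes values in R[i] (on the
   nonnegative real axis), as always for a normed module over R[i]. *)
Record hilbertSpace (R : realType) := HilbertSpace {
  hilbert_sort :> completeNormedModType R[i] ;
  hdot : {dot hilbert_sort for (@Num.conj R[i])} ;
  hdot_norm : forall v : hilbert_sort, `|v| ^+ 2 = hdot v v }.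

Definition unitary_op (R : realType) (H : hilbertSpace R)
    (u : {linear H -> H}) : Prop :=
  isometry (hdot H) (hdot H) u /\ bijective u.

(* G carries no topology, so no continuity is required of s |-> rep_op s. *)
Record unitaryRep (R : realType) (G : groupType) := UnitaryRep {
  rep_space :> hilbertSpace R ;
  rep_op : G -> {linear rep_space -> rep_space} ;
  rep_unitary : forall s, unitary_op (rep_op s) ;
  rep_op1 : forall v, rep_op 1%g v = v ;
  rep_opM : forall s t v, rep_op (s * t)%g v = rep_op s (rep_op t v) }.

(* There is at most one such p for a subspace M, and exactly one when M is
   closed (projection theorem); the default value 0 is then never used. *)
Definition orth_proj (R : realType) (H : hilbertSpace R) (M : set H) (v : H) :
    H :=
  xget 0 [set p | M p /\ forall w, M w -> hdot H (v - p) w = 0].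

Definition invariant_vectors (R : realType) (G : groupType)
    (pi : unitaryRep R G) : set pi :=
  [set v | forall s, rep_op pi s v = v].

Definition inv_proj (R : realType) (G : groupType) (pi : unitaryRep R G) :
    pi -> pi :=
  orth_proj (invariant_vectors (pi := pi)).

Definition ltranslate (G : groupType) (t : G) (F : {fset G}) : {fset G} :=
  [fset (t * x)%g | x in F].

Definition fset_symdiff (T : choiceType) (A B : {fset T}) : {fset T} :=
  (A `\` B) `|` (B `\` A).

Definition left_folner (R : realType) (G : groupType) (F : nat -> {fset G}) :
    Prop :=
  (forall n, F n != fset0) /\
  forall t : G,
    (#|` fset_symdiff (F n) (ltranslate t (F n))|%:R / #|` F n|%:R : R)
      @[n --> \oo] --> (0 : R).

Definition left_strong_ergodic_theorem (R : realType) (G : groupType) : Prop :=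
  forall (pi : unitaryRep R G) (F : nat -> {fset G}), left_folner R F ->
  forall v : pi,
    (#|` F n|%:R : R[i])^-1 *: (\sum_(s <- F n) rep_op pi s v)
      @[n --> \oo] --> inv_proj v.

Definition firm_strong_sequence_for (R : realType) (G : groupType)
    (pi : unitaryRep R G) (K : nat -> {fset G}) : Prop :=
  (forall m, K m != fset0) /\
  forall (t : nat -> G) (v : pi),
    (#|` K m|%:R : R[i])^-1 *: (\sum_(s <- K m) rep_op pi (s * t m)%g v)
      @[m --> \oo] --> inv_proj v.

Definition firm_strong_sequence (R : realType) (G : groupType)
    (K : nat -> {fset G}) : Prop :=
  forall pi : unitaryRep R G, firm_strong_sequence_for pi K.

(* A left-invariant mean on l^oo(G), given by a function on all of G -> R whose
   values outside of the bounded functions are irrelevant. *)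
Definition left_invariant_mean (R : realType) (G : groupType)
    (m : (G -> R) -> R) : Prop :=
  [/\ forall (a : R) (f g : G -> R), bounded_fun f -> bounded_fun g ->
        m (fun x => a * f x + g x) = a * m f + m g,
      forall f : G -> R, bounded_fun f -> (forall x, 0 <= f x) -> 0 <= m f,
      m (fun=> 1) = 1 &
      forall (t : G) (f : G -> R), bounded_fun f ->
        m (fun x => f (t * x)%g) = m f].

Definition amenable (R : realType) (G : groupType) : Prop :=
  exists m : (G -> R) -> R, left_invariant_mean m.

(* Main.v *)
Require Import Defs.
From mathcomp Require Import all_boot all_algebra finmap.
From mathcomp Require Import all_classical all_reals.
From mathcomp Require Import all_order complex all_analysis zify.

(** If K is firm, then convergence of the averages over [K m] is uniform over
    right translates. For a left Folner sequence F, the average over [F n] is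
    nearly fixed by each of the finitely many elements of [K m], so it is close
    to the average over [K m] of its translates, which is an average over
    [s \in F n] of the vectors [average (K m) (pi s v)], all uniformly close to
    the projection. Conversely, right translates of a left Folner sequence are
    left Folner, so the ergodic theorem makes any left Folner sequence firm.

    The existence of a left Folner sequence is obtained from the invariant mean
    by contradiction. If no finite set is (S, 1/(k+1))-invariant, then iterated
    S-neighbourhoods at least double every finite set, and Hall's marriage
    theorem yields an injection G * bool -> G that moves points by finitely many
    left translations: a paradoxical decomposition, excluded by the mean. *)

Set Implicit Arguments.
Unset Strict Implicit.
Unset Printing Implicit Defensive.

Import Order.TTheory GRing.Theory Num.Theory.
Import numFieldNormedType.Exports.

Local Open Scope classical_set_scope.
Local Open Scope fset_scope.

(** * Hall's marriage theorem over an arbitrary index set *)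

Section Hall.
Variables I Y : choiceType.

Definition hall_condition (A : I -> {fset Y}) : Prop :=
  forall J : {fset I}, (#|` J| <= #|` \bigcup_(j <- J) A j|)%N.

Lemma fset_bigcup_mono (A B : I -> {fset Y}) (J J' : {fset I}) :
  J `<=` J' -> (forall j, j \in J -> A j `<=` B j) ->
  \bigcup_(j <- J) A j `<=` \bigcup_(j <- J') B j.
Proof.
move=> /fsubsetP sJ sAB; apply/bigfcupsP => j jJ _.
by apply: (fsubset_trans (sAB j jJ)); apply: bigfcup_sup => //; apply: sJ.
Qed.

(* Intersect the chain: on a finite J the intersection is attained at the member
   of C minimizing the total size of the sets indexed by J. *)
Lemma hall_chain_bound (A : I -> {fset Y}) (C : set (I -> {fset Y})) :
  C A -> (forall B, C B -> hall_condition B) ->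
  total_on C (fun B B' => forall i, B i `<=` B' i) ->
  hall_condition
    (fun i => [fset y in A i | `[< forall B, C B -> y \in B i >] ]).
Proof.
move=> CA hC totC J.
pose w (B : I -> {fset Y}) := (\sum_(j <- J) #|` B j|)%N.
have exw : exists n, `[< exists2 B, C B & w B = n >].
  by exists (w A); apply/asboolP; exists A.
case: (ex_minnP exw) => n /asboolP[B CB wB] minw.
apply: (leq_trans (hC B CB J)); apply/fsubset_leq_card/fset_bigcup_mono => // j jJ.
have minB B' : C B' -> B j `<=` B' j.
  move=> CB'; have [//|sub] := totC _ _ CB CB'.
  suff -> : B' j = B j by [].
  apply/eqP; rewrite eqEfcard sub /= leqNgt; apply/negP => ltB.
  have /minw : `[< exists2 B'', C B'' & w B'' = w B' >].
    by apply/asboolP; exists B'.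
  rewrite -wB leqNgt => /negP; apply.
  rewrite /w !(big_fsetD1 j jJ) /= -addSn; apply: leq_add => //.
  by apply: leq_sum => i _; apply: fsubset_leq_card.
apply/fsubsetP => y yB; rewrite !inE /=; apply/andP; split.
  exact: (fsubsetP (minB _ CA)).
by apply/asboolP => B' CB'; apply: (fsubsetP (minB _ CB')).
Qed.

(** A violating index set must contain [i], the only index whose set shrinks; [J] is that index set
    without [i]. *)
Lemma hall_condition_remove (A : I -> {fset Y}) (i : I) (x : Y) :
  hall_condition A ->
  ~ hall_condition (fun j => if j == i then A j `\ x else A j) ->
  exists2 J : {fset I}, i \notin J &
    (#|` (\bigcup_(j <- J) A j) `|` (A i `\ x)| <= #|` J|)%N.
Proof.
move=> hA /existsNP[J /negP]; rewrite -ltnNge => ltJ.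
have iJ : i \in J.
  apply/negPn/negP => niJ; move: ltJ; rewrite ltnNge => /negP; apply.
  apply: (leq_trans (hA J)); apply/fsubset_leq_card/fset_bigcup_mono => // j jJ.
  by case: eqP => // ji; move: niJ; rewrite -ji jJ.
exists (J `\ i); first by rewrite !inE eqxx.
rewrite (cardfsD1 i J) iJ ltnS in ltJ; apply: leq_trans ltJ.
apply: fsubset_leq_card; rewrite fsubUset; apply/andP; split.
  apply: fset_bigcup_mono; first exact: fsubD1set.
  by move=> j; rewrite !inE => /andP[/negPf ->].
by apply: (fsubset_trans _ (bigfcup_sup _ iJ _)) => //; rewrite eqxx.
Qed.

(* Rado: if both x and y could not be removed from [A i], the two tight index sets
   J1 and J2 would contradict submodularity of the cardinality of unions. *)
Lemma hall_minimal_unique (A : I -> {fset Y}) :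
  hall_condition A ->
  (forall B, hall_condition B -> (forall i, B i `<=` A i) ->
     forall i, A i `<=` B i) ->
  forall i x y, x \in A i -> y \in A i -> x = y.
Proof.
move=> hA minA i x y xA yA; apply/eqP/negPn/negP => xy.
have rem z : z \in A i -> ~ hall_condition
    (fun j => if j == i then A j `\ z else A j).
  move=> zA h; suff /fsubsetP/(_ z zA) : A i `<=` A i `\ z by rewrite !inE eqxx.
  have := minA _ h; rewrite /= => /(_ _ i); rewrite eqxx; apply => j.
  by case: eqP => // _; apply: fsubD1set.
have [J1 iJ1 le1] := hall_condition_remove hA (rem x xA).
have [J2 iJ2 le2] := hall_condition_remove hA (rem y yA).
(* As [x] and [y] differ, the union of the two sets contains all of [A i], so its size exceeds that
   of the union of [J1] and [J2]; their intersection contains every [A j] with [j] common to [J1]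
   and [J2]. *)
have := leq_add le1 le2; rewrite -cardfsUI -[leqRHS]cardfsUI leqNgt => /negP; apply.
rewrite -addSn; apply: leq_add; last first.
  apply: (leq_trans (hA _)); apply: fsubset_leq_card.
  rewrite fsubsetI; apply/andP; split; apply: fsubset_trans (fsubsetUl _ _);
    apply: fset_bigcup_mono => //; [exact: fsubsetIl | exact: fsubsetIr].
have -> : (#|` J1 `|` J2|).+1 = #|` i |` (J1 `|` J2)|.
  by rewrite cardfsU1 !inE negb_or iJ1 iJ2.
apply: (leq_trans (hA _)); apply: fsubset_leq_card.
apply/bigfcupsP => j; rewrite !inE => /or3P[/eqP ->|jJ|jJ] _; apply/fsubsetP => z zA.
- rewrite !inE zA; case: (eqVneq z x) => [->|]; rewrite ?xy ?orbT //.
- rewrite !inE; apply/orP; left; apply/orP; left.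
  by apply/bigfcupP; exists j; rewrite ?jJ.
- rewrite !inE; apply/orP; right; apply/orP; left.
  by apply/bigfcupP; exists j; rewrite ?jJ.
Qed.

(** Zorn's lemma gives a minimal subfamily with the Hall condition; its members are singletons,
    distinct by the condition on pairs of indices. *)
Theorem hall_marriage (A : I -> {fset Y}) :
  hall_condition A ->
  exists2 f : I -> Y, injective f & forall i, f i \in A i.
Proof.
move=> hA.
pose T := {B : I -> {fset Y} | hall_condition B /\ forall i, B i `<=` A i}.
(* Reverse inclusion: a maximal element is a minimal family. *)
pose R (B B' : T) := `[< forall i, sval B' i `<=` sval B i >].
have [||C totC|[B [hB sBA]] maxB] :=
    @ZL_preorder T (exist _ A (conj hA (fun i => fsubset_refl (A i)))) R.
- by move=> B; apply/asboolP => i.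
- move=> B1 B2 B3 /asboolP s12 /asboolP s23; apply/asboolP => i.
  exact: fsubset_trans (s23 i) (s12 i).
(* Adding [A] gives the empty chain a bound too. *)
- pose D := ((@sval _ _ @` C) `|` [set A])%classic.
  have hD : hall_condition
      (fun i => [fset y in A i | `[< forall B, D B -> y \in B i >] ]).
    apply: hall_chain_bound.
    + by right.
    + by move=> B [[[B' [hB' ?]] _ <-]|->].
    + move=> B B' [[E CE <-]|->] [[E' CE' <-]|->].
      * by case: (totC _ _ CE CE') => /asboolP; [right|left].
      * by left=> i; case: (svalP E).
      * by right=> i; case: (svalP E').
      * by left.
  have sD i : [fset y in A i | `[< forall B, D B -> y \in B i >] ] `<=` A i.
    by apply/fsubsetP => y; rewrite !inE => /andP[].
  exists (exist _ (fun i => [fset y in A i | `[< forall B, D B -> y \in B i >] ])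
    (conj hD sD)) => B CB; apply/asboolP => i /=.
  apply/fsubsetP => y; rewrite !inE /= => /andP[_ /asboolP]; apply.
  by left; exists B.
have minB B' : hall_condition B' -> (forall i, B' i `<=` B i) ->
    forall i, B i `<=` B' i.
  move=> hB' sB'; have sA i : B' i `<=` A i := fsubset_trans (sB' i) (sBA i).
  have /asboolP // : R (exist _ B' (conj hB' sA)) (exist _ B (conj hB sBA)).
  by apply: (maxB (exist _ B' (conj hB' sA))); apply/asboolP.
have [f fB] : {f : I -> Y & forall i, f i \in B i}.
  apply: (@choice _ _ (fun i y => y \in B i)) => i; apply/fset0Pn.
  by rewrite -cardfs_gt0; have := hB [fset i]; rewrite big_seq_fset1 cardfs1.
have Bf i : B i = [fset f i].
  apply/fsetP => y; rewrite inE; apply/idP/eqP => [yB|-> //].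
  exact: (hall_minimal_unique hB minB yB).
exists f; last by move=> i; apply: (fsubsetP (sBA i)).
move=> i j fij; apply/eqP/negPn/negP => ij.
have := hB [fset i; j].
rewrite cardfs2 ij big_fsetU1 ?inE //= big_seq_fset1 !Bf fij.
by rewrite [X in #|` X|]fsetUid cardfs1.
Qed.

End Hall.

(** * Growth of finite sets under left translations *)

Section Neighbourhoods.
Variables (G : groupType).
Implicit Types (S F : {fset G}) (t x y : G).

Lemma in_ltranslate t F y : (y \in ltranslate t F) = ((t^-1 * y)%g \in F).
Proof.
apply/imfsetP/idP => [[x xF ->]|yF]; first by rewrite mulKg.
by exists (t^-1 * y)%g; rewrite ?mulVKg.
Qed.

Lemma card_ltranslate t F : #|` ltranslate t F| = #|` F|.
Proof. by rewrite card_imfset //=; apply: mulgI. Qed.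

Lemma card_symdiff_ltranslate t F :
  #|` fset_symdiff F (ltranslate t F)| = #|` ltranslate t F `\` F|.*2.
Proof.
have e : #|` F `\` ltranslate t F| = #|` ltranslate t F `\` F|.
  by rewrite !cardfsD card_ltranslate fsetIC.
have d : (F `\` ltranslate t F) `&` (ltranslate t F `\` F) = fset0.
  by apply/fsetP => x; rewrite !inE; case: (x \in F); rewrite ?andbF.
by have := cardfsUI (F `\` ltranslate t F) (ltranslate t F `\` F);
  rewrite d cardfs0 addn0 e addnn.
Qed.

(** Keeping [F] makes the iterates increase even if [S] lacks the identity. *)
Definition fset_nbhd S F : {fset G} :=
  F `|` \bigcup_(t <- S) ltranslate t F.

Lemma in_fset_nbhd S F y :
  reflect (y \in F \/ exists2 t, t \in S & (t^-1 * y)%g \in F)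
          (y \in fset_nbhd S F).
Proof.
rewrite inE; apply: (iffP orP) => -[yF|]; [by left| |by left|].
  by case/bigfcupP => t; rewrite andbT in_ltranslate => tS yF; right; exists t.
move=> [t tS yF]; right; apply/bigfcupP; exists t; rewrite ?tS //.
by rewrite in_ltranslate.
Qed.

(* Right translations commute with taking neighbourhoods. *)
Lemma in_iter_fset_nbhd S n F y :
  reflect (exists2 x, x \in F & (y * x^-1)%g \in iter n (fset_nbhd S) [fset 1%g])
          (y \in iter n (fset_nbhd S) F).
Proof.
elim: n y => [|n IH] y /=.
  apply: (iffP idP) => [yF|[x xF]]; first by exists y; rewrite ?divgg ?inE.
  by rewrite inE divg_eq1 => /eqP ->.
apply: (iffP (in_fset_nbhd S _ y)).
  move=> [/IH[x xF yx]|[t tS /IH[x xF yx]]]; exists x => //.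
    by apply/in_fset_nbhd; left.
  by apply/in_fset_nbhd; right; exists t; rewrite // mulgA.
move=> [x xF /in_fset_nbhd[yx|[t tS yx]]]; [left|right].
  by apply/IH; exists x.
by exists t => //; apply/IH; exists x; rewrite // -mulgA.
Qed.

(** Half of a symmetric difference consists of new points, so each step adds at least a fraction
    1/(2(k+1)) of the current size, hence of the size of [F]; after 2(k+1) steps the size has
    doubled. *)
Lemma card_iter_fset_nbhd S k F :
  (forall F', F' != fset0 -> exists2 t, t \in S &
     (#|` F'| < k.+1 * #|` fset_symdiff F' (ltranslate t F')|)%N) ->
  (2 * #|` F| <= #|` iter (k.+1.*2) (fset_nbhd S) F|)%N.
Proof.
move=> expand; have [->|F0] := eqVneq F fset0; first by rewrite cardfs0 muln0.
pose a n := #|` iter n (fset_nbhd S) F|.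
have sub n : iter n (fset_nbhd S) F `<=` iter n.+1 (fset_nbhd S) F.
  by rewrite iterS; apply: fsubsetUl.
have a0 n : (a 0 <= a n)%N.
  by elim: n => // n /leq_trans; apply; apply: fsubset_leq_card.
have step n : (a n + k.+1.*2 * a n <= k.+1.*2 * a n.+1)%N.
  have /expand[t tS] : iter n (fset_nbhd S) F != fset0.
    by rewrite -cardfs_gt0; apply: leq_trans (a0 n); rewrite cardfs_gt0.
  set E := iter n (fset_nbhd S) F => ltE.
  rewrite card_symdiff_ltranslate in ltE.
  have leE : (a n + #|` ltranslate t E `\` E| <= a n.+1)%N.
    have <- : #|` E `|` (ltranslate t E `\` E)| = (a n + #|` ltranslate t E `\` E|)%N.
      rewrite cardfsU -/E (_ : E `&` _ = fset0) ?cardfs0 ?subn0 //.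
      by apply/fsetP => x; rewrite !inE; case: (x \in E); rewrite ?andbF.
    apply: fsubset_leq_card; rewrite [iter n.+1 _ _]iterS -/E.
    apply: fsetUS; apply: (fsubset_trans (fsubsetDl _ _)).
    exact: (bigfcup_sup (fun t => ltranslate t E) tS).
  rewrite /a -/E in leE *; nia.
have lin n : (n * a 0 + k.+1.*2 * a 0 <= k.+1.*2 * a n)%N.
  elim: n => [//|n IH]; have := step n; have := a0 n; nia.
have := lin k.+1.*2; rewrite -/(a _) -[#|` F|]/(a 0); nia.
Qed.

(** Two copies of each point are matched into its [n]-fold neighbourhood. A finite set of pairs has
    at most twice as many elements as first coordinates, so doubling yields Hall's condition. *)
Lemma not_folner_injection S k :
  (forall F, F != fset0 -> exists2 t, t \in S &
     (#|` F| < k.+1 * #|` fset_symdiff F (ltranslate t F)|)%N) ->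
  exists T : {fset G}, exists2 f : G * bool -> G,
    injective f & forall p, (f p * p.1^-1)%g \in T.
Proof.
move=> /card_iter_fset_nbhd; move: k.+1.*2 => n double.
pose T := iter n (fset_nbhd S) [fset 1%g].
have [J|f injf fT] := @hall_marriage (G * bool)%type G
    (fun p => iter n (fset_nbhd S) [fset p.1]); last first.
  exists T, f => // p; have /in_iter_fset_nbhd[x] := fT p.
  by rewrite inE => /eqP ->.
pose J1 := [fset p.1 | p in J].
have le1 : (#|` J| <= 2 * #|` J1|)%N.
  pose Jb b := [fset p in J | p.2 == b].
  have cJb b : (#|` Jb b| <= #|` J1|)%N.
    have <- : #|` [fset p.1 | p in Jb b]| = #|` Jb b|.
      apply: card_in_imfset => -[x b1] [y b2] /=; rewrite !inE /=.
      by move=> /andP[_ /eqP->] /andP[_ /eqP->] ->.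
    apply: fsubset_leq_card; apply/fsubsetP => x /imfsetP[p /=].
    by rewrite !inE => /andP[pJ _] ->; apply/imfsetP; exists p.
  have -> : J = Jb true `|` Jb false.
    by apply/fsetP => -[x []]; rewrite !inE /= ?andbT ?andbF ?orbF.
  rewrite mul2n -addnn; apply: leq_trans (leq_add (cJb true) (cJb false)).
  by rewrite cardfsU leq_subr.
apply: (leq_trans le1); apply: (leq_trans (double J1)).
apply: fsubset_leq_card; apply/fsubsetP => y /in_iter_fset_nbhd[x].
case/imfsetP => p /= pJ -> yx; apply/bigfcupP; exists p; rewrite ?andbT //=.
by apply/in_iter_fset_nbhd; exists p.1; rewrite ?inE.
Qed.

End Neighbourhoods.

Local Open Scope ring_scope.

(** * Invariant means exclude paradoxical decompositions *)

Lemma bounded_fun_le (R : realType) (T : Type) (f : T -> R) (M : R) :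
  (forall x, `|f x| <= M) -> bounded_fun f.
Proof.
move=> fM; exists M; split; first exact: num_real.
by move=> N /ltW MN x _; apply: le_trans (fM x) MN.
Qed.

Section Mean.
Variables (R : realType) (G : groupType) (m : (G -> R) -> R).
Hypothesis mean_m : left_invariant_mean m.

Lemma mean_le (f g : G -> R) : bounded_fun f -> bounded_fun g ->
  (forall x, f x <= g x) -> m f <= m g.
Proof.
case: mean_m => lin pos _ _ bf bg fg.
have := lin (-1) f g bf bg; rewrite mulN1r => e.
rewrite -subr_ge0 addrC -e; apply: pos => [|x]; last first.
  by rewrite mulN1r addrC subr_ge0.
have -> : (fun x => -1 * f x + g x) = (g - f : G -> R^o).
  by apply/funext => x; rewrite mulN1r addrC.
by apply: bounded_funD => //; apply: bounded_funN.
Qed.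

Lemma mean_cst (a : R) : m (fun=> a) = a.
Proof.
case: mean_m => lin _ m1 _.
have b c : bounded_fun (fun _ : G => c : R) by apply: (@bounded_fun_le _ _ _ `|c|).
have m0 : m (fun=> 0) = 0.
  have := lin 1 _ _ (b 0) (b 0); under [X in m X]eq_fun do rewrite mul1r addr0.
  by rewrite mul1r => /eqP; rewrite -subr_eq0 opprD addrA subrr sub0r oppr_eq0 => /eqP.
have := lin a _ _ (b 1) (b 0); under [X in m X]eq_fun do rewrite mulr1 addr0.
by rewrite m1 m0 mulr1 addr0.
Qed.

(** Boundedness is carried through the induction because linearity of [m] is assumed on bounded
    functions only. *)
Lemma mean_sum (I : Type) (r : seq I) (F : I -> G -> R) :
  (forall i, bounded_fun (F i)) ->
  bounded_fun (fun x => \sum_(i <- r) F i x) /\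
  m (fun x => \sum_(i <- r) F i x) = \sum_(i <- r) m (F i).
Proof.
case: mean_m => lin _ _ _ bF; elim: r => [|i r [IHb IH]].
  have -> : (fun x => \sum_(i <- [::]) F i x) = fun=> 0.
    by apply/funext => x; rewrite big_nil.
  rewrite big_nil mean_cst; split => //.
  by apply: (@bounded_fun_le _ _ _ 0) => x; rewrite normr0.
have -> : (fun x => \sum_(j <- i :: r) F j x) =
    (fun x => 1 * F i x + \sum_(j <- r) F j x).
  by apply/funext => x; rewrite big_cons mul1r.
split; last by rewrite big_cons -IH lin // mul1r.
under [X in bounded_fun X]eq_fun do rewrite mul1r.
exact: (@bounded_funD _ R (F i) (fun x => \sum_(i <- r) F i x)).
Qed.

(* Otherwise [x |-> f (x, true)] and [x |-> f (x, false)] would be piecewise left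
   translations mapping G onto two disjoint subsets, forcing [2 <= 1]. *)
Lemma mean_no_injection (T : {fset G}) (f : G * bool -> G) :
  injective f -> ~ forall p, (f p * p.1^-1)%g \in T.
Proof.
move=> injf fT; case: (mean_m) => _ _ _ inv.
pose r := T `*` [fset true; false].
(* For [q = (t, b)], the indicator of the [x] that [f (_, b)] moves by [t]; precomposing with left
   translation by [t^-1] gives the indicator of the image of this set under [f (_, b)]. *)
pose piece (q : G * bool) (x : G) : R := (f (x, q.2) == (q.1 * x)%g)%:R.
have b0 (b : bool) : `|b%:R : R| <= 1 by case: b; rewrite ?normr1 ?normr0.
have bpiece q : bounded_fun (piece q).
  by apply: (@bounded_fun_le _ _ _ 1) => x; apply: b0.
have bpiece' q : bounded_fun (fun x => piece q (q.1^-1 * x)%g).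
  by apply: (@bounded_fun_le _ _ _ 1) => x; apply: b0.
have bcst c : bounded_fun (fun _ : G => c : R) by apply: (@bounded_fun_le _ _ _ `|c|).
have [bsum msum] := mean_sum r bpiece.
have [bsum' msum'] := mean_sum r bpiece'.
(* Every [x] lies in one piece for each of the two Booleans. *)
have : 2 <= m (fun x => \sum_(q <- r) piece q x).
  rewrite -[leLHS]mean_cst; apply: mean_le => // x.
  pose q b := ((f (x, b) * x^-1)%g, b).
  have qr b : q b \in r by rewrite !inE (fT (x, b)); case: b.
  have pq b : piece (q b) x = 1 by rewrite /piece /= mulgVK eqxx.
  rewrite (big_fsetD1 (q true)) //= (big_fsetD1 (q false)) /=; last first.
    by rewrite in_fsetD1 qr andbT xpair_eqE andbF.
  by rewrite !pq addrA lerDl; apply: sumr_ge0 => ? _.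
(* By injectivity of [f], every [y] lies in at most one of the image pieces. *)
have : m (fun x => \sum_(q <- r) piece q (q.1^-1 * x)%g) <= 1.
  rewrite -[leRHS]mean_cst; apply: mean_le => // y.
  have [[q qr fq]|none] := pselect (exists2 q, q \in r & f ((q.1^-1 * y)%g, q.2) = y).
    rewrite (big_fsetD1 q) //= big_seq big1 ?addr0 => [|q' ].
      by rewrite (le_trans (ler_norm _)) // b0.
    rewrite in_fsetD1 => /andP[q'q _]; rewrite /piece mulVKg.
    case: eqP => // fq'; case/negP: q'q; move: fq'; rewrite -[RHS]fq.
    case: q q' {qr fq} => [t b] [t' b'] /= /injf [/mulIg/invg_inj -> ->] //.
  rewrite big_seq big1 // => q qr; rewrite /piece mulVKg.
  by case: eqP => // fq; case: none; exists q.
rewrite msum msum'; under eq_bigr do rewrite inv //.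
by move=> h1 h2; have := le_trans h2 h1; rewrite (ler_nat R 2 1).
Qed.

End Mean.

(** * Construction of a left Folner sequence *)

Lemma amenable_folner_set (R : realType) (G : groupType) (S : {fset G}) (k : nat) :
  amenable R G ->
  exists2 F : {fset G}, F != fset0 & forall t, t \in S ->
    (k.+1 * #|` fset_symdiff F (ltranslate t F)| <= #|` F|)%N.
Proof.
move=> [m mean_m]; apply: contrapT => noF.
have [|T [f injf fT]] := @not_folner_injection G S k; last first.
  exact: (mean_no_injection mean_m injf fT).
move=> F F0; apply: contrapT => not; apply: noF; exists F => // t tS.
by rewrite leqNgt; apply/negP => lt; apply: not; exists t.
Qed.

(** [F n] is nearly invariant under the finitely many elements of code below [n]; each [t] is
    eventually among them, and its ratio is then at most 1/(n+1). *)
Lemma amenable_left_folner (R : realType) (G : groupType) :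
  countable [set: G] -> amenable R G ->
  exists F : nat -> {fset G}, left_folner R F.
Proof.
move=> /countable_injP[code inj_code] am.
have fin n : finite_set (code @^-1` `I_n).
  by apply: finite_preimage => // x y _ _; apply: inj_code; rewrite inE.
have /choice[F Fprop] n : exists F : {fset G}, F != fset0 /\
    forall t, (code t < n)%N ->
    (n.+1 * #|` fset_symdiff F (ltranslate t F)| <= #|` F|)%N.
  have [F F0 HF] := amenable_folner_set (fset_set (code @^-1` `I_n)) n am.
  by exists F; split=> // t tn; apply: HF; rewrite in_fset_set // inE.
exists F; split=> [n|t]; first by case: (Fprop n).
apply: (squeeze_cvgr (f := fun=> 0) (h := harmonic)); last 2 first.
- exact: cvg_cst.
- exact: cvg_harmonic.
near=> n; have [F0 /(_ t) HF] := Fprop n.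
rewrite divr_ge0 //= /harmonic ler_pdivrMr ?ltr0n ?cardfs_gt0 //.
rewrite ler_pdivlMl ?ltr0n // -natrM ler_nat HF //.
by near: n; exists (code t).+1.
Unshelve. all: by end_near.
Qed.

Local Open Scope complex_scope.

(** * Norm estimates for finite sums and averages *)

Section SumNorm.
Variables (R : realType) (T : choiceType) (V : normedModType R[i]).
Implicit Types (A B : {fset T}) (f : T -> V) (c : R[i]).

Lemma norm_sum_fset_le A f c :
  (forall s, s \in A -> `|f s| <= c) -> `|\sum_(s <- A) f s| <= #|` A|%:R * c.
Proof.
move=> fc; apply: (le_trans (ler_norm_sum _ _ _)).
rewrite big_seq (le_trans (ler_sum _ fc)) // -big_seq.
by rewrite big_const_seq count_predT iter_addr_0 mulr_natl.
Qed.

(** The terms over the intersection cancel. *)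
Lemma norm_sum_fsetB_le A B f c :
  (forall s, `|f s| <= c) ->
  `|\sum_(s <- A) f s - \sum_(s <- B) f s| <= #|` fset_symdiff A B|%:R * c.
Proof.
move=> fc.
have split (X Y : {fset T}) :
    \sum_(s <- X) f s = \sum_(s <- X `&` Y) f s + \sum_(s <- X `\` Y) f s.
  rewrite (big_fsetID _ (mem Y)) /=; congr (_ + _); apply: eq_fbigl => x;
    by rewrite !inE // andbC.
rewrite (split A B) (split B A) fsetIC opprD addrACA subrr add0r.
have -> : #|` fset_symdiff A B| = (#|` A `\` B| + #|` B `\` A|)%N.
  rewrite cardfsU (_ : _ `&` _ = fset0) ?cardfs0 ?subn0 //.
  by apply/fsetP => x; rewrite !inE; case: (x \in A); rewrite ?andbF.
rewrite natrD mulrDl (le_trans (ler_normB _ _)) // lerD //;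
  by apply: norm_sum_fset_le.
Qed.

Lemma average_dist_le A f (w : V) c : A != fset0 -> (forall s, s \in A -> `|w - f s| <= c) ->
  `|w - (#|` A|%:R : R[i])^-1 *: \sum_(s <- A) f s| <= c.
Proof.
rewrite -cardfs_gt0 => A0 wf.
have nA : (#|` A|%:R : R[i]) != 0 by rewrite pnatr_eq0 -lt0n.
have -> : w - (#|` A|%:R : R[i])^-1 *: \sum_(s <- A) f s =
    (#|` A|%:R : R[i])^-1 *: \sum_(s <- A) (w - f s).
  rewrite sumrB big_const_seq count_predT iter_addr_0 -[w *+ _]scaler_nat.
  by rewrite scalerBr scalerA mulVf // scale1r.
rewrite normrZ normfV normr_nat ler_pdivrMl ?ltr0n //.
exact: norm_sum_fset_le.
Qed.

End SumNorm.

(** * From firm sequences to the ergodic theorem *)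

Section Averages.
Variables (R : realType) (G : groupType).

Definition average (pi : unitaryRep R G) (A : {fset G}) (v : pi) : pi :=
  (#|` A|%:R : R[i])^-1 *: \sum_(s <- A) rep_op pi s v.

Lemma norm_rep_op (pi : unitaryRep R G) (s : G) (v : pi) :
  `|rep_op pi s v| = `|v|.
Proof.
have [iso _] := rep_unitary pi s.
by apply: (@pexpIrn _ 2); rewrite ?nnegrE // !hdot_norm iso.
Qed.

Lemma rep_op_average (pi : unitaryRep R G) (t : G) (A : {fset G}) (v : pi) :
  rep_op pi t (average A v) = average (ltranslate t A) v.
Proof.
rewrite /average card_ltranslate linearZ linear_sum; congr (_ *: _).
rewrite big_imfset /=; last by move=> x y _ _; apply: mulgI.
by apply: eq_bigr => s _; rewrite rep_opM.
Qed.

(** The translated average is the average over [ltranslate t A], and by unitarity every term has the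
    norm of [v]. *)
Lemma average_translate_le (pi : unitaryRep R G) (t : G) (A : {fset G}) (v : pi) :
  `|average A v - rep_op pi t (average A v)| <=
    #|` fset_symdiff A (ltranslate t A)|%:R / #|` A|%:R * `|v|.
Proof.
rewrite rep_op_average /average card_ltranslate -scalerBr normrZ.
rewrite normfV normr_nat mulrC mulrAC ler_wpM2r ?invr_ge0 ?ler0n //.
by apply: norm_sum_fsetB_le => s; rewrite norm_rep_op.
Qed.

Lemma left_folner_complex (F : nat -> {fset G}) (t : G) (e : R[i]) :
  left_folner R F -> 0 < e ->
  \forall n \near \oo,
    (#|` fset_symdiff (F n) (ltranslate t (F n))|%:R / #|` F n|%:R : R[i]) < e.
Proof.
move=> [_ /(_ t) /cvgrPdist_lt cvgF].
(* A positive element of [R[i]] has zero imaginary part, so the real limit applies. *)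
case: e => a b; rewrite ltcE /= => /andP[/eqP -> a0].
apply: filterS (cvgF a a0) => n /=.
rewrite sub0r normrN ger0_norm ?divr_ge0 // => lt_a.
have -> : (#|` fset_symdiff (F n) (ltranslate t (F n))|%:R / #|` F n|%:R : R[i])
    = (#|` fset_symdiff (F n) (ltranslate t (F n))|%:R / #|` F n|%:R)%:C.
  by rewrite rmorphM fmorphV !rmorph_nat.
by rewrite ltcR.
Qed.

Lemma average_comm (pi : unitaryRep R G) (A B : {fset G}) (v : pi) :
  average A (average B v) =
    (#|` B|%:R : R[i])^-1 *: \sum_(s <- B) average A (rep_op pi s v).
Proof.
rewrite {1}/average; under eq_bigr do rewrite linearZ linear_sum /=.
rewrite -!scaler_sumr exchange_big /= !scalerA mulrC -scalerA; congr (_ *: _).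
Qed.

(* A sequence of worst translates [t_m] turns convergence along every [t] into
   convergence uniform in [G]. *)
Lemma firm_strong_sequence_uniform (pi : unitaryRep R G) (K : nat -> {fset G})
    (v : pi) (e : R[i]) :
  firm_strong_sequence_for pi K -> 0 < e ->
  exists m, forall s, `|inv_proj v - average (K m) (rep_op pi s v)| < e.
Proof.
move=> [_ firm] e0; apply: contrapT => not.
have /choice[t tP] m : exists s,
    ~ `|inv_proj v - average (K m) (rep_op pi s v)| < e.
  by apply/existsNP => all_lt; apply: not; exists m.
have /cvgrPdist_lt /(_ e e0) [m _ /(_ m (leqnn m))] := firm t v.
move=> /= lt_e; case: (tP m).
by rewrite /average; under eq_bigr do rewrite -rep_opM.
Qed.

Lemma firm_strong_sequence_ergodic (pi : unitaryRep R G) (K F : nat -> {fset G})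
    (v : pi) : firm_strong_sequence_for pi K -> left_folner R F ->
  average (F n) v @[n --> \oo] --> inv_proj v.
Proof.
move=> firm folF; apply/cvgrPdist_lt => e e0.
have e20 : 0 < e / 2 by rewrite divr_gt0.
have [m unif] := firm_strong_sequence_uniform v firm e20.
have [Kne _] := firm; have [Fne _] := folF.
(* Chosen so that [d] times the norm of [v] is below [e / 2]; the [+ 1] covers [v = 0]. *)
pose d := e / 2 / (`|v| + 1).
have v1 : 0 < `|v| + 1 by rewrite ltr_wpDl.
have d0 : 0 < d by rewrite divr_gt0.
(* [m] is fixed before [n] and [K m] is finite, so only finitely many Folner conditions are imposed
   at once. *)
have near_translates : \forall n \near \oo, forall t, t \in K m ->
    (#|` fset_symdiff (F n) (ltranslate t (F n))|%:R / #|` F n|%:R : R[i]) < d.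
  apply: filterS (@filter_bigI _ _ (K m) (fun t => [set n | (#|` fset_symdiff (F n)
    (ltranslate t (F n))|%:R / #|` F n|%:R : R[i]) < d]) \oo _ _) => [n Kn t tK|t _].
    exact: Kn.
  exact: left_folner_complex.
near=> n.
(* The intermediate point: near the projection by uniformity of [K m], near [average (F n) v] by its
   almost invariance. *)
pose double := average (K m) (average (F n) v).
have -> : inv_proj v - average (F n) v =
    (inv_proj v - double) - (average (F n) v - double).
  by rewrite opprB addrA subrK.
apply: le_lt_trans (ler_normB _ _) _; rewrite (splitr e); apply: ler_ltD.
  rewrite /double average_comm; apply: average_dist_le => // s _.
  exact: ltW.
apply: (@le_lt_trans _ _ (d * `|v|)).
  apply: average_dist_le => // t tK.
  apply: le_trans (average_translate_le _ _ _) _.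
  apply: ler_wpM2r => //; apply/ltW; move: t tK; near: n; exact: near_translates.
by rewrite /d -mulrA gtr_pMr // mulrC ltr_pdivrMr // mul1r ltrDl.
Unshelve. all: by end_near.
Qed.

End Averages.

(** * From the ergodic theorem to firm sequences *)

Section RightTranslates.
Variable G : groupType.
Implicit Types (A B F : {fset G}) (t u x y : G).

Definition rtranslate u F : {fset G} := [fset (x * u)%g | x in F].

Lemma in_rtranslate u F y : (y \in rtranslate u F) = ((y * u^-1)%g \in F).
Proof.
apply/imfsetP/idP => [[x xF ->]|yF]; first by rewrite mulgK.
by exists (y * u^-1)%g; rewrite ?mulgVK.
Qed.

Lemma card_rtranslate u F : #|` rtranslate u F| = #|` F|.
Proof. by rewrite card_imfset //=; apply: mulIg. Qed.

(** Right translations commute with left ones and preserve sizes, so each Folner ratio is unchanged,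
    even though [u n] varies with [n]. *)
Lemma left_folner_rtranslate (R : realType) (F : nat -> {fset G}) (u : nat -> G) :
  left_folner R F -> left_folner R (fun n => rtranslate (u n) (F n)).
Proof.
move=> [F0 cvgF]; split=> [n|t].
  by rewrite -cardfs_gt0 card_rtranslate cardfs_gt0.
apply: cvg_trans (cvgF t); apply: near_eq_cvg; near=> n.
have -> : fset_symdiff (rtranslate (u n) (F n)) (ltranslate t (rtranslate (u n) (F n)))
    = rtranslate (u n) (fset_symdiff (F n) (ltranslate t (F n))).
  by apply/fsetP => x; rewrite !(inE, in_rtranslate, in_ltranslate) mulgA.
by rewrite !card_rtranslate.
Unshelve. all: by end_near.
Qed.

End RightTranslates.

(** Averaging [rep_op pi (s * t n) v] over [s] in [F n] is averaging over the right translate of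
    [F n] by [t n]. *)
Lemma ergodic_firm_strong_sequence (R : realType) (G : groupType)
    (F : nat -> {fset G}) :
  left_strong_ergodic_theorem R G -> left_folner R F ->
  firm_strong_sequence R F.
Proof.
move=> lset folF pi; split=> [m|t v]; first by case: folF.
apply: cvg_trans (lset pi _ (left_folner_rtranslate t folF) v).
apply: near_eq_cvg; near=> n.
rewrite card_rtranslate big_imfset //= => x y _ _; exact: mulIg.
Unshelve. all: by end_near.
Qed.

Theorem proposition1p1 (R : realType) (G : groupType) (G_countable : countable [set: G]) (G_amenable : amenable R G) :
  left_strong_ergodic_theorem R G <->
  exists K : nat -> {fset G}, firm_strong_sequence R K.
Proof.
split=> [lset|[K firm] pi F folF v].
  have [F folF] := amenable_left_folner G_countable G_amenable.
  by exists F; apply: ergodic_firm_strong_sequence.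
exact: firm_strong_sequence_ergodic (firm pi) folF.
Qed.
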